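(* There are absolute constants $c>0$ and $C$ such that the following holds for all $n$. Let $f\colon\{0,1\}^n\to\{0,1\}$ be a uniformly random balanced function. Then with probability at least $1-2^{-2^{cn}}$ there exists a mapping $\phi$ from ${\sf Dictator}$ to $f$ such that $\Pr_{x}[{\sf dist}(x,\phi(x))\le 2]\ge 1-C/n$ for $x$ uniform in $\{0,1\}^n$. In particular, with this probability, ${\sf avgStretch}(\phi)\le C'$ and ${\sf avgStretch}(\phi^{-1})\le C'$ for an absolute constant $C'$.
   Context: A balanced function has exactly $2^{n-1}$ inputs mapped to $1$; a uniformly random balanced function is uniform among these. ${\sf Dictator}(x)=x_1$. A mapping from $g$ to $f$ is a bijection $\phi$ of $\{0,1\}^n$ with $g(z)=f(\phi(z))$ for all $z$. ${\sf avgStretch}(\phi)=\mathbb{E}_{x,i}[{\sf dist}(\phi(x),\phi(x+e_i))]$ with $x$ uniform in $\{0,1\}^n$, $i$ uniform in $[n]$, ${\sf dist}$ Hamming distance. *)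

(* Defs.v *)
From Stdlib Require Import Reals.
From mathcomp Require Import all_boot all_fingroup.
Set Implicit Arguments. Unset Strict Implicit. Unset Printing Implicit Defensive.

(* The hypercube {0,1}^n, coordinates indexed by 'I_n (paper's x_1 is index 0). *)
Definition cube (n : nat) := {ffun 'I_n -> bool}.

Definition boolfun (n : nat) := {ffun cube n -> bool}.

Definition balanced (n : nat) (f : boolfun n) : bool :=
  #|[set x : cube n | f x]| == 2 ^ n.-1.

(* Dictator(x) = x_1 (first coordinate; meaningful for n >= 1) *)
Definition dictator (n : nat) (x : cube n) : bool :=
  [exists i : 'I_n, (val i == 0) && x i].

Definition flip (n : nat) (x : cube n) (i : 'I_n) : cube n :=
  [ffun j => if j == i then ~~ x j else x j].

Definition dist (n : nat) (x y : cube n) : nat := #|[set i | x i != y i]|.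

Definition is_mapping (n : nat) (g f : cube n -> bool) (phi : {perm cube n}) : bool :=
  [forall z : cube n, g z == f (phi z)].

Definition avgStretch (n : nat) (phi : {perm cube n}) : R :=
  Rdiv (INR (\sum_(x : cube n) \sum_(i < n) dist (phi x) (phi (flip x i))))
       (INR (2 ^ n * n)).

Definition prob_close (n : nat) (phi : {perm cube n}) : R :=
  Rdiv (INR #|[set x : cube n | dist x (phi x) <= 2]|) (INR (2 ^ n)).

Definition Rleb (x y : R) : bool := if Rle_dec x y then true else false.

Definition good_event (n : nat) (C C' : R) (f : boolfun n) : bool :=
  [exists phi : {perm cube n},
    [&& is_mapping (@dictator n) f phi,
        Rleb (Rminus 1 (Rdiv C (INR n))) (prob_close phi),
        Rleb (avgStretch phi) C' &
        Rleb (avgStretch (phi^-1)%g) C']].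

Definition prob_balanced (n : nat) (E : boolfun n -> bool) : R :=
  Rdiv (INR #|[set f : boolfun n | balanced f && E f]|)
       (INR #|[set f : boolfun n | balanced f]|).

(* Main.v *)
(** Split the cube into pairs {x, x + e_0}, e_0 being the dictator's direction.  On a
pair where f takes both values, fixing both points or exchanging them aligns f with
the dictator.  The other pairs, of type 00 or 11, are matched greedily: in round i a
surviving 00-pair and a surviving 11-pair that differ by e_i are matched, which moves
a point of each by e_0 + e_i, i.e. by distance 2.  What happened at x and at x + e_i
before round i depends on values of f on disjoint subcubes, so the probability of
surviving with a given type satisfies p_(i+1) = p_i - p_i^2 with p_0 = 1/4, whence
p_k <= 1/(k+4).  For k about n/2 and each fixed setting of the coordinates 0..k,
survival is independent over the 2^(n-k-1) settings of the other coordinates, so by a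
Chernoff bound more than O(2^n/n) points survive only with doubly exponentially
small probability.  Conditioning on balancedness costs only a factor 2^(n+1), survivors are repaired by transpositions,
and the stretch bounds follow from the triangle inequality, since distances are at
most n. *)

Require Import Defs.
From Stdlib Require Import Reals Lra.
From mathcomp Require Import all_boot all_fingroup.
From mathcomp Require Import zify_ssreflect.
Set Implicit Arguments. Unset Strict Implicit. Unset Printing Implicit Defensive.

(* [Reals] shadows the Hamming distance, and [zify_ssreflect] rebinds [%R]. *)
Local Notation dist := Defs.dist.
Delimit Scope R_scope with R.

(** * Repairing a permutation by transpositions *)

(** Induction on the number of bad points, those with [g z != f (phi z)]. Swapping the images of two
    bad points of opposite [g]-value repairs both and leaves the good points alone. *)
Lemma perm_correct (T : finType) (g f : pred T) (phi : {perm T}) :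
  #|[set z | g z]| = #|[set z | f z]| ->
  exists phi' : {perm T}, (forall z, g z = f (phi' z)) /\
    (forall z, g z = f (phi z) -> phi' z = phi z).
Proof.
move=> card_gf.
have [m] := ubnP #|[set z | g z != f (phi z)]|.
elim: m phi => // m IHm phi; rewrite ltnS => le_m.
have [good|[z]] := set_0Vmem [set z | g z != f (phi z)].
  exists phi; split=> // z; apply/eqP/negPn.
  by move/setP/(_ z): good; rewrite !inE => ->.
rewrite inE => bad_z.
have card_phi : #|[set x | f (phi x)]| = #|[set x | g x]|.
  rewrite card_gf -(card_imset _ (@perm_inj _ phi)); congr #|pred_of_set _|.
  apply/setP=> y; rewrite inE; apply/imsetP/idP => [[x]|fy].
    by rewrite inE => ? ->.
  by exists ((phi^-1)%g y); rewrite ?inE permKV.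
(* If all bad points had the same [g]-value, one of the sets of ones of [g] and of [f \o phi] would
   strictly contain the other, against equality of their sizes. *)
have [z' bad_z' gz'] : exists2 z', g z' != f (phi z') & g z' != g z.
  case: (pickP [pred x | (g x != f (phi x)) && (g x != g z)]) => [x /andP[]|none].
    by exists x.
  have same x : g x != f (phi x) -> g x = g z.
    by move=> bad_x; have /= := none x; rewrite bad_x /= => /negbFE/eqP.
  have [] : #|[set x | f (phi x)]| < #|[set x | g x]| \/
            #|[set x | g x]| < #|[set x | f (phi x)]|;
    last 1 [by rewrite card_phi ltnn | by rewrite card_phi ltnn].
  case gz: (g z); [left | right]; apply: proper_card; apply/properP; split.
  - by apply/subsetP=> x; rewrite !inE; move: (same x); rewrite gz; case: (g x); case: (f _) => //= /(_ isT).
  - by exists z; rewrite !inE ?gz //; move: bad_z; rewrite gz; case: (f _).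
  - by apply/subsetP=> x; rewrite !inE; move: (same x); rewrite gz; case: (g x); case: (f _) => //= /(_ isT).
  - by exists z; rewrite !inE ?gz //; move: bad_z; rewrite gz; case: (f _).
pose phi1 := (tperm z z' * phi)%g.
have good1 x : g x = f (phi x) -> phi1 x = phi x.
  move=> gx; rewrite permM tpermD //; apply/eqP=> e.
    by move: bad_z; rewrite e gx eqxx.
  by move: bad_z'; rewrite e gx eqxx.
have [|phi' [map' ext']] := IHm phi1.
  apply: leq_trans le_m; apply: proper_card; apply/properP; split.
    apply/subsetP=> x; rewrite !inE; apply: contra => /eqP gx.
    by rewrite good1 // gx.
  exists z; rewrite !inE ?bad_z // permM tpermL.
  by move: bad_z' gz'; do 2 case: (g _); case: (f _).
exists phi'; split=> // x gx; rewrite -(good1 _ gx); apply: ext'.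
by rewrite good1.
Qed.

(** * Flips, Hamming distance and the greedy matching *)

Section Hypercube.
Variable n : nat.
Implicit Types (x y z : cube n) (f g : boolfun n) (i : nat).

(* [flip] at the coordinate of value [i]; the identity when [n <= i]. *)
Definition flip_nat x i : cube n := [ffun j => if val j == i then ~~ x j else x j].

Lemma flip_natK i : involutive (flip_nat^~ i).
Proof. by move=> x; apply/ffunP=> j; rewrite !ffunE; case: eqP => // _; rewrite negbK. Qed.

Lemma flip_natC x i j : flip_nat (flip_nat x i) j = flip_nat (flip_nat x j) i.
Proof. by apply/ffunP=> k; rewrite !ffunE; do 2 case: eqP. Qed.

Lemma dist_flip_nat_le x y i : dist x (flip_nat y i) <= (dist x y).+1.
Proof.
rewrite /dist.
have [lt_in|le_ni] := ltnP i n; last first.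
  apply: leqW; apply: subset_leq_card; apply/subsetP=> j; rewrite !inE ffunE.
  by have [ji|//] := eqVneq (val j) i; move: (ltn_ord j); rewrite ltnNge ji le_ni.
apply: leq_trans (_ : #|Ordinal lt_in |: [set j | x j != y j]| <= _); last first.
  by rewrite cardsU1; case: (_ \notin _).
apply: subset_leq_card; apply/subsetP=> j; rewrite !inE ffunE.
by rewrite -val_eqE /=; case: (nat_of_ord j == i).
Qed.

Lemma dist_self x : dist x x = 0.
Proof. by apply/eqP; rewrite cards_eq0; apply/eqP/setP=> j; rewrite !inE eqxx. Qed.

Lemma distC x y : dist x y = dist y x.
Proof. by congr #|pred_of_set _|; apply/setP=> j; rewrite !inE eq_sym. Qed.

Lemma dist_triangle y x z : dist x z <= dist x y + dist y z.
Proof.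
apply: leq_trans (leq_card_setU _ _); apply: subset_leq_card.
by apply/subsetP=> j; rewrite !inE; do 3 case: (_ j).
Qed.

Lemma dist_le x y : dist x y <= n.
Proof. by rewrite -[leqRHS]card_ord max_card. Qed.

Lemma dictator_flip0 x : 0 < n -> dictator (flip_nat x 0) = ~~ dictator x.
Proof.
move=> n0; have dictE y : dictator y = y (Ordinal n0).
  apply/existsP/idP => [[i /andP[/eqP i0]]|yi].
    by have -> : i = Ordinal n0 by apply: val_inj.
  by exists (Ordinal n0); rewrite yi.
by rewrite !dictE ffunE.
Qed.

Lemma dictator_flipS x i : dictator (flip_nat x i.+1) = dictator x.
Proof. by apply: eq_existsb => j; rewrite ffunE; case: (val j =P 0) => //= ->. Qed.

(* A point survives round 0 when [f] agrees on the pair {x, x + e_0}; in round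
   [i.+1] surviving pairs adjacent along [e_(i+1)] and of opposite values are
   matched and drop out. *)
Fixpoint unmatched (f : boolfun n) i x : bool :=
  if i is i'.+1 then
    unmatched f i' x && ~~ (unmatched f i' (flip_nat x i) && (f x != f (flip_nat x i)))
  else f x == f (flip_nat x 0).

Lemma unmatched_val0 f i x : unmatched f i x -> f (flip_nat x 0) = f x.
Proof. by elim: i => [/eqP//|i IHi /= /andP[/IHi]]. Qed.

Lemma unmatched_flip0 f i x : unmatched f i (flip_nat x 0) = unmatched f i x.
Proof.
elim: i x => [|i IHi] x /=; first by rewrite flip_natK eq_sym.
rewrite (flip_natC x) !IHi.
have [/unmatched_val0 ->|//] := boolP (unmatched f i x).
by have [/unmatched_val0 ->|//] := boolP (unmatched f i (flip_nat x i.+1)).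
Qed.

(** Induction on rounds: survivors stay fixed, so a newly matched point may be redirected without
    disturbing earlier choices. Of each newly matched point, either [f] already agrees with the
    dictator there, or it jumps to the partner pair, where [f] takes the opposite value. *)
Lemma pairing_involution f i : 0 < n ->
  exists psi : cube n -> cube n, involutive psi /\
    forall x, [/\ dist x (psi x) <= 2, unmatched f i x -> psi x = x
                & ~~ unmatched f i x -> f (psi x) = dictator x].
Proof.
move=> n0; elim: i => [|i [psi [psiK psiP]]] /=.
  exists (fun x => if (f x == f (flip_nat x 0)) || (f x == dictator x) then x
                   else flip_nat x 0); split=> [x|x].
    have [e|ne] := boolP ((f x == f (flip_nat x 0)) || (f x == dictator x)).
      by rewrite e.
    rewrite flip_natK dictator_flip0 // ifN //.
    by move: ne; do 2 case: (f _); case: (dictator x).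
  split.
  - case: ifP => _; rewrite ?dist_self //.
    by apply: leq_trans (dist_flip_nat_le _ _ _) _; rewrite dist_self.
  - by move->.
  - move=> ne; rewrite (negbTE ne) /=; have [//|] := eqVneq (f x) (dictator x).
    by move: ne; do 2 case: (f _); case: (dictator x).
pose new x := [&& unmatched f i x, unmatched f i (flip_nat x i.+1) & f x != f (flip_nat x i.+1)].
(* Translation by e_0 + e_(i+1) negates both [f] and the dictator on newly matched points. Hence the
   condition [f x != dictator x] is preserved, and the new map is again an involution. *)
pose jump x := flip_nat (flip_nat x i.+1) 0.
have jumpK : involutive jump by move=> x; rewrite /jump flip_natC flip_natK flip_natK.
have f_jump x : new x -> f (jump x) = ~~ f x.
  by case/and3P=> _ /unmatched_val0 -> ; do 2 case: (f _).
have new_jump x : new x -> new (jump x).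
  move=> newx; rewrite /new (f_jump _ newx) {1}/jump [flip_nat (jump x) _]flip_natC flip_natK.
  case/and3P: newx => u v _; rewrite !unmatched_flip0 u v /=.
  by rewrite (unmatched_val0 u); case: (f x).
have dict_jump x : dictator (jump x) = ~~ dictator x.
  by rewrite dictator_flip0 // dictator_flipS.
have psi_unm x : unmatched f i (psi x) = unmatched f i x.
  apply/idP/idP => [u|/(let: And3 _ h _ := psiP x in h) ->//].
  by have [_ /(_ u) + _] := psiP (psi x); rewrite psiK => {1}->.
exists (fun x => if new x && (f x != dictator x) then jump x else psi x); split=> [x|x].
  have [/andP[newx fx]|old] := boolP (new x && (f x != dictator x)).
    rewrite ifT ?jumpK // new_jump // f_jump // dict_jump.
    by move: fx; case: (f x); case: (dictator x).
  have [u|u] := boolP (unmatched f i x).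
    by have [_ /(_ u) -> _] := psiP x; rewrite (negbTE old); have [_ /(_ u) -> _] := psiP x.
  by rewrite ifN ?psiK // negb_and /new psi_unm (negbTE u).
split.
- case: ifP => _; last by case: (psiP x).
  apply: leq_trans (dist_flip_nat_le _ _ _) _.
  by apply: leq_trans (dist_flip_nat_le _ _ _) _; rewrite dist_self.
- case/andP=> u nn; rewrite ifN; first by have [_ ->] := psiP x.
  by rewrite negb_and /new u nn.
- have [u|u _] := boolP (unmatched f i x); last first.
    by rewrite ifN ?(negbTE u) //; [case: (psiP x) => _ _ -> | rewrite /new (negbTE u)].
  rewrite /= negbK => h; have newx : new x by rewrite /new u.
  rewrite newx /=; case: eqP => [<-|].
    by have [_ /(_ u) -> _] := psiP x.
  by rewrite f_jump //; case: (f x); case: (dictator x).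
Qed.

Lemma card_cube : #|cube n| = 2 ^ n.
Proof. by rewrite card_ffun card_bool card_ord. Qed.

Lemma card_dictator : 0 < n -> #|[set x : cube n | dictator x]| = 2 ^ n.-1.
Proof.
move=> n0; apply/eqP; rewrite -(eqn_pmul2l (isT : 0 < 2)) -expnS prednK // mul2n -addnn.
rewrite -card_cube -(cardsC [set x : cube n | dictator x]) eqn_add2l.
rewrite -(card_imset _ (inv_inj (flip_natK 0))); apply/eqP/eq_card => x.
rewrite !inE; apply/imsetP/idP => [[y]|nx].
  by rewrite inE => dy ->; rewrite dictator_flip0 // dy.
by exists (flip_nat x 0); rewrite ?flip_natK // inE dictator_flip0.
Qed.

Definition far (phi : {perm cube n}) : nat := #|[set x | 2 < dist x (phi x)]|.

(** The involution moves every point by at most 2 and is wrong only at survivors; the repair changes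
    nothing elsewhere. *)
Lemma ex_near_mapping f i : 0 < n -> balanced f ->
  exists phi : {perm cube n},
    (forall z, dictator z = f (phi z)) /\ far phi <= #|[set x | unmatched f i x]|.
Proof.
move=> n0 /eqP bal_f; have [psi [psiK psiP]] := pairing_involution f i n0.
have [|phi [map_phi ext_phi]] := @perm_correct _ (@dictator n) f (perm (inv_inj psiK)).
  by rewrite card_dictator.
exists phi; split=> //; apply: subset_leq_card; apply/subsetP=> x; rewrite !inE.
apply: contraLR => u; have [le2 _ /(_ u) fpsi] := psiP x.
by rewrite -leqNgt ext_phi permE.
Qed.

(** * From few far points to bounded stretch *)

Lemma sum_dist_le (phi : {perm cube n}) :
  \sum_x dist x (phi x) <= 2 * 2 ^ n + n * far phi.
Proof.
rewrite -card_cube /far -sum1_card (mulnC 2) -sum_nat_const big_distrr /= .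
rewrite [X in _ + X]big_mkcond -big_split /=; apply: leq_sum => x _; rewrite inE.
by case: leqP => [//|_]; rewrite muln1; apply: leq_trans (dist_le _ _) (leq_addl _ _).
Qed.

(** Triangle inequality along [phi x], [x], [flip x i], [phi (flip x i)]. Since a flip permutes the
    cube, both outer legs have the same sum. *)
Lemma sum_stretch_le (phi : {perm cube n}) :
  \sum_x \sum_(i < n) dist (phi x) (phi (flip x i)) <=
  n * 2 ^ n + 2 * n * \sum_x dist x (phi x).
Proof.
have stepE x (i : 'I_n) : flip x i = flip_nat x i by [].
apply: leq_trans (_ : \sum_x \sum_(i < n) (1 + dist x (phi x) +
    dist (flip_nat x i) (phi (flip_nat x i))) <= _).
  apply: leq_sum => x _; apply: leq_sum => i _; rewrite stepE.
  apply: leq_trans (dist_triangle (flip_nat x i) _ _) _; rewrite leq_add2r.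
  apply: leq_trans (dist_triangle x _ _) _; rewrite addnC (distC (phi x)) leq_add2r.
  by have := dist_flip_nat_le x x i; rewrite dist_self.
under eq_bigr do rewrite big_split /= sum_nat_const card_ord.
rewrite big_split /= -big_distrr /= big_split /= sum_nat_const muln1.
rewrite [X in _ + X]exchange_big /=.
have shiftE (i : nat) : \sum_x dist (flip_nat x i) (phi (flip_nat x i)) = \sum_x dist x (phi x).
  by rewrite [RHS](reindex_inj (inv_inj (flip_natK i))).
under [X in _ + X <= _]eq_bigr do rewrite shiftE.
rewrite sum_nat_const card_ord; have -> : #|{: cube n}| = 2 ^ n by exact: card_cube.
by rewrite mulnDr -addnA mul2n -addnn mulnDl.
Qed.

Lemma sum_dist_perm_inv (phi : {perm cube n}) :
  \sum_x dist x ((phi^-1)%g x) = \sum_x dist x (phi x).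
Proof.
by rewrite (reindex_inj (@perm_inj _ phi)); apply: eq_bigr => x _; rewrite permK distC.
Qed.

Lemma INR_divn_le a b k : 0 < b -> a <= k * b -> Rle (INR a / INR b)%R (INR k).
Proof.
move=> b0 /leP/le_INR; rewrite mult_INR => le_ab.
have b0' : Rlt 0 (INR b) by apply: lt_0_INR; apply/ltP.
apply: (Rmult_le_reg_r (INR b)) => //; rewrite /Rdiv Rmult_assoc Rinv_l ?Rmult_1_r //.
exact: Rgt_not_eq.
Qed.

Lemma avgStretch_le (phi : {perm cube n}) k : 0 < n ->
  n * \sum_x dist x (phi x) <= k * (n * 2 ^ n) -> Rle (avgStretch phi) (INR (1 + 2 * k)).
Proof.
move=> n0 le_k; apply: INR_divn_le; first by rewrite muln_gt0 expn_gt0.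
by apply: leq_trans (sum_stretch_le phi) _; lia.
Qed.

Lemma RlebP a b : reflect (Rle a b) (Rleb a b).
Proof. by rewrite /Rleb; case: Rle_dec => h; constructor. Qed.

(** A fraction k/n of far points, each moved by at most n, gives average displacement at most 2 + k,
    the same for the inverse; the stretch is then at most 1 + 2(2 + k). *)
Lemma good_event_far f (phi : {perm cube n}) k : 0 < n ->
  (forall z, dictator z = f (phi z)) -> n * far phi <= k * 2 ^ n ->
  good_event (INR k) (INR (5 + 2 * k)) f.
Proof.
move=> n0 map_phi le_far; apply/existsP; exists phi.
have le_dist : n * \sum_x dist x (phi x) <= (2 + k) * (n * 2 ^ n).
  apply: leq_trans (_ : n * (2 * 2 ^ n + n * far phi) <= _).
    by rewrite leq_mul2l sum_dist_le orbT.
  by nia.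
have -> : 5 + 2 * k = 1 + 2 * (2 + k) by lia.
apply/and4P; split.
- by apply/forallP=> z; rewrite map_phi.
- apply/RlebP.
  have cardE : #|[set x | dist x (phi x) <= 2]| + far phi = 2 ^ n.
    rewrite -card_cube -(cardsC [set x | dist x (phi x) <= 2]); congr (_ + _).
    by apply: eq_card => x; rewrite !inE ltnNge.
  have n0' : Rlt 0 (INR n) by apply: lt_0_INR; apply/ltP.
  have e0 : Rlt 0 (INR (2 ^ n)) by apply: lt_0_INR; apply/ltP; rewrite expn_gt0.
  move/leP/le_INR: le_far; rewrite !mult_INR => le_far.
  rewrite /prob_close.
  have -> : INR #|[set x | dist x (phi x) <= 2]| = Rminus (INR (2 ^ n)) (INR (far phi)).
    by rewrite -cardE plus_INR; lra.
  apply: (Rmult_le_reg_r (INR n * INR (2 ^ n))%R); first exact: Rmult_lt_0_compat.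
  apply: (Rle_trans _ (INR n * INR (2 ^ n) - INR k * INR (2 ^ n))%R).
    by apply: Req_le; field; lra.
  apply: (Rle_trans _ (INR n * INR (2 ^ n) - INR n * INR (far phi))%R).
    by lra.
  by apply: Req_le; field; lra.
- by apply/RlebP; apply: avgStretch_le.
- by apply/RlebP; apply: avgStretch_le => //; rewrite sum_dist_perm_inv.
Qed.
End Hypercube.

(** * Independence and exponential moments for random functions *)

Section Independence.
Variable T : finType.
Implicit Types (S : pred T) (f g : {ffun T -> bool}).

Definition determined_on S (V : Type) (h : {ffun T -> bool} -> V) : Prop :=
  forall f g, (forall x, S x -> f x = g x) -> h f = h g.

Let M := #|{ffun T -> bool}|.

(* Exchanging the values of [f] and [g] on [S1] is an involution of the pairs
   [(f, g)] that turns [h1 f * h2 g] into [h1 f * h2 f]. *)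
Lemma sum_mul_indep S1 S2 (h1 h2 : {ffun T -> bool} -> nat) :
  determined_on S1 h1 -> determined_on S2 h2 -> (forall x, S1 x -> ~~ S2 x) ->
  M * (\sum_f h1 f * h2 f) = (\sum_f h1 f) * (\sum_f h2 f).
Proof.
move=> det1 det2 disj.
pose mix f g : {ffun T -> bool} := [ffun x => if S1 x then g x else f x].
pose swap (p : {ffun T -> bool} * {ffun T -> bool}) := (mix p.1 p.2, mix p.2 p.1).
have swapK : involutive swap.
  by case=> f g; congr (_, _); apply/ffunP=> x; rewrite !ffunE; case: (S1 x).
rewrite mulnC big_distrl /=.
transitivity (\sum_(p : {ffun T -> bool} * {ffun T -> bool}) h1 p.2 * h2 p.1).
  rewrite (reindex_inj (inv_inj swapK)) /= -(pair_bigA _ (fun f g => h1 (mix g f) * h2 (mix f g))) /=.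
  apply: eq_bigr => f _; rewrite -/M mulnC -sum_nat_const; apply: eq_bigr => g _.
  congr (_ * _); [apply: det1 | apply: det2] => x Sx; rewrite ffunE.
    by rewrite Sx.
  by case: ifP => // /disj; rewrite Sx.
rewrite -(pair_bigA _ (fun f g => h1 g * h2 f)) /= exchange_big big_distrl /=.
by apply: eq_bigr => f _; rewrite big_distrr.
Qed.

Lemma sum_val_eq (x : T) (b : bool) : 2 * \sum_(f : {ffun T -> bool}) (f x == b) = M.
Proof.
pose neg f : {ffun T -> bool} := [ffun y => ~~ f y].
have negK : involutive neg by move=> f; apply/ffunP=> y; rewrite !ffunE negbK.
rewrite mul2n -addnn {2}(reindex_inj (inv_inj negK)) /= -big_split /= /M -sum1_card.
by apply: eq_bigr => f _; rewrite ffunE; case: (f x); case: b.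
Qed.

(* A bound on the moment generating function of the number of events [W i], each of
   probability at most [t / s], cleared of denominators. *)
Lemma sum_exp_count_le (I : eqType) (S : I -> pred T)
    (W : I -> {ffun T -> bool} -> bool) (s t : nat) (l : seq I) :
  uniq l -> (forall i, determined_on (S i) (W i)) ->
  {in l &, forall i j, i != j -> forall x, S i x -> ~~ S j x} ->
  {in l, forall i, s * \sum_f W i f <= t * M} ->
  s ^ size l * \sum_f 2 ^ count (W^~ f) l <= (s + t) ^ size l * M.
Proof.
move=> + detW; elim: l => [_ _ _|i l IHl /= /andP[i_l uniq_l] disj leW].
  by rewrite /= !mul1n sum_nat_const muln1.
have M0 : 0 < M by rewrite /M card_ffun expn_gt0 card_bool.
have {}IHl : s ^ size l * \sum_f 2 ^ count (W^~ f) l <= (s + t) ^ size l * M.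
  apply: IHl => // [j k lj lk|j lj]; last by apply: leW; rewrite inE lj orbT.
  by apply: disj; rewrite inE ?lj ?lk orbT.
rewrite -(leq_pmul2l M0) mulnCA.
under eq_bigr do rewrite expnD.
(* The head event depends on values on [S i], the remaining count on values on the union of the
   other [S j], which is disjoint from it. *)
rewrite (@sum_mul_indep (S i) [pred x | has (fun j => S j x) l]); first last.
- move=> x Six; apply/hasPn => j lj; apply: (disj i j) Six; rewrite ?inE ?eqxx ?lj ?orbT //.
  by apply: contraNneq i_l => ->.
- move=> f g fg; congr (2 ^ _); apply: eq_in_count => j lj /=.
  by apply: detW => x Sjx; apply: fg; apply/hasP; exists j.
- by move=> f g fg; rewrite (detW i f g).
(* For an indicator, 2^W = 1 + W, so each event contributes a factor of at most (s + t) / s. *)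
have -> : \sum_f 2 ^ W i f = M + \sum_f W i f.
  rewrite /M -sum1_card -big_split /=; apply: eq_bigr => f _.
  by case: (W i f).
have leWi : s * (M + \sum_f W i f) <= (s + t) * M.
  by rewrite mulnDr mulnDl leq_add2l leW // inE eqxx.
rewrite !expnS mulnACA; apply: leq_trans (leq_mul leWi IHl) _.
by rewrite -[leqLHS]mulnA [leqLHS]mulnCA (mulnA (s + t)).
Qed.
End Independence.

(** * Survival probabilities and blocks of independent points *)

Section Survivors.
Variable n : nat.
Implicit Types (x y z : cube n) (f g : boolfun n) (i k : nat).

(** The subcube through [x] in which coordinates 0 to [i] are free; rounds up to [i] at [x] read [f]
    only there. *)
Definition agree_above i x : pred (cube n) :=
  fun y => [forall j : 'I_n, (i < j) ==> (x j == y j)].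

Lemma agree_aboveP i x y :
  reflect (forall j : 'I_n, i < j -> x j = y j) (agree_above i x y).
Proof.
by apply: (iffP forallP) => h j; [move=> ij; apply/eqP/(implyP (h j)) | apply/implyP=> /h/eqP].
Qed.

Lemma agree_above_refl i x : agree_above i x x.
Proof. exact/agree_aboveP. Qed.

Lemma agree_aboveS i x y : agree_above i x y -> agree_above i.+1 x y.
Proof. by move/agree_aboveP=> h; apply/agree_aboveP=> j /ltnW/h. Qed.

Lemma agree_above_flip i x y : agree_above i (flip_nat x i.+1) y -> agree_above i.+1 x y.
Proof.
move/agree_aboveP=> h; apply/agree_aboveP=> j ij; rewrite -h ?(ltnW ij) // ffunE.
by rewrite gtn_eqF.
Qed.

Lemma agree_above_flip_disjoint i x y :
  i.+1 < n -> agree_above i x y -> ~~ agree_above i (flip_nat x i.+1) y.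
Proof.
move=> lt_in /agree_aboveP h; apply/negP=> /agree_aboveP/(_ (Ordinal lt_in) (ltnSn _)).
by rewrite -h ?ltnSn // ffunE eqxx; case: (x _).
Qed.

Lemma unmatched_local i x : determined_on (agree_above i x) (fun f => unmatched f i x).
Proof.
elim: i x => [|i IHi] x f g fg /=.
  rewrite !fg ?agree_above_refl //; apply/agree_aboveP=> j; rewrite ffunE.
  by move/gtn_eqF->.
rewrite (IHi x f g); last by move=> y /agree_aboveS/fg.
rewrite (IHi (flip_nat x i.+1) f g); last by move=> y /agree_above_flip/fg.
by rewrite !fg ?agree_above_refl // agree_above_flip ?agree_above_refl.
Qed.

Lemma unmatched_val_local i x (b : bool) :
  determined_on (agree_above i x) (fun f => unmatched f i x && (f x == b) : nat).
Proof. by move=> f g fg; rewrite (unmatched_local fg) fg ?agree_above_refl. Qed.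

Let M := #|boolfun n|.

Lemma card_boolfun_gt0 : 0 < M.
Proof. by rewrite /M card_ffun expn_gt0 card_bool. Qed.

(* The fraction p_i of functions leaving [x] unmatched with a given value obeys
   p_0 = 1/4 and p_(i+1) = p_i - p_i^2, hence p_i <= 1/(i+4). *)
Lemma card_unmatched_val i : i < n ->
  exists2 a, (i + 4) * a <= M &
    forall x (b : bool), \sum_(f : boolfun n) (unmatched f i x && (f x == b)) = a.
Proof.
elim: i => [n0|i IHi lt_in].
  have cntE x (b : bool) : 4 * \sum_(f : boolfun n) (unmatched f 0 x && (f x == b)) = M.
    apply/eqP; rewrite -(eqn_pmul2l card_boolfun_gt0); apply/eqP.
    rewrite (eq_bigr (fun f : boolfun n => (f x == b) * (f (flip_nat x 0) == b))); last first.
      by move=> f _ /=; case: (f x); case: (f (flip_nat x 0)); case: b.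
    rewrite mulnCA (@sum_mul_indep _ (pred1 x) (pred1 (flip_nat x 0))).
    - by rewrite (mulnACA 2 2) !sum_val_eq.
    - by move=> f g ->//=.
    - by move=> f g ->//=.
    - move=> y /= /eqP->; apply/eqP => /ffunP/(_ (Ordinal n0)); rewrite ffunE /=.
      by case: (x _).
  exists (M %/ 4) => [|x b]; first by rewrite mulnC leq_trunc_div.
  by rewrite -(cntE x b) mulKn.
have [a le_a cntE] := IHi (ltnW lt_in).
pose x0 : cube n := [ffun=> false].
(* A survivor [x] of value [b] drops out exactly when its neighbour survives with value [~~ b]. The
   two events live on disjoint subcubes, so they have joint probability p_i^2. *)
have stepE x (b : bool) : M * \sum_(f : boolfun n) (unmatched f i.+1 x && (f x == b)) + a * a = M * a.
  rewrite -{1}(cntE x b) -{1}(cntE (flip_nat x i.+1) (~~ b)).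
  rewrite -(sum_mul_indep (@unmatched_val_local i x b) (@unmatched_val_local i _ _));
    last by move=> y; apply: agree_above_flip_disjoint.
  rewrite -mulnDr -big_split /= -[in RHS](cntE x b); congr (_ * _); apply: eq_bigr => f _.
  by do 2 case: (unmatched _ _ _); do 2 case: (f _); case: b.
(* The count at one arbitrary point serves as witness, since [stepE] determines it independently of
   [x] and [b]. *)
exists (\sum_(f : boolfun n) (unmatched f i.+1 x0 && (f x0 == true))).
  (* With p = a / M: p <= 1/(i+4) implies p - p^2 <= 1/(i+5), because (i+3)(i+5) < (i+4)^2. *)
  move: card_boolfun_gt0 le_a (stepE x0 true); move: (\sum_f _) => a' M0 le_a stepa.
  rewrite -(leq_pmul2l M0).
  have [r Mr] : exists r, M = (i + 4) * a + r by exists (M - (i + 4) * a); rewrite subnKC.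
  by rewrite Mr in stepa *; nia.
move=> x b; apply/eqP; rewrite -(eqn_pmul2l card_boolfun_gt0).
by rewrite -(eqn_add2r (a * a)) !stepE.
Qed.

Lemma card_unmatched_le i x : i < n ->
  (i + 4) * \sum_(f : boolfun n) unmatched f i x <= 2 * M.
Proof.
move=> /card_unmatched_val[a le_a cntE].
have -> : \sum_(f : boolfun n) unmatched f i x = a + a.
  rewrite -{1}(cntE x true) -(cntE x false) -big_split /=; apply: eq_bigr => f _.
  by case: (f x); rewrite ?andbT ?andbF ?addn0.
by lia.
Qed.

(* The blocks are indexed redundantly by all their points; [z] ranging over the cube
   counts each of them equally often. *)
Definition block k z : {set cube n} := [set x : cube n | [forall j : 'I_n, (j <= k) ==> (x j == z j)]].

Lemma block_sym k x z : (x \in block k z) = (z \in block k x).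
Proof. by rewrite !inE; apply: eq_forallb => j; rewrite eq_sym. Qed.

(** Distinct points of a block differ at a coordinate above [k]. This makes survival independent
    across a block. *)
Lemma block_disjoint k z : {in block k z &, forall x y, x != y ->
  forall w, agree_above k x w -> ~~ agree_above k y w}.
Proof.
move=> x y; rewrite !inE => /forallP xz /forallP yz ne w /agree_aboveP xw.
apply: contraNN ne => /agree_aboveP yw; apply/eqP/ffunP=> j.
have [jk|kj] := leqP j k; last by rewrite xw // yw.
by rewrite (eqP (implyP (xz j) jk)) (eqP (implyP (yz j) jk)).
Qed.

Lemma card_block k z : k < n -> #|block k z| = 2 ^ (n - k.+1).
Proof.
move=> lt_kn.
pose F (j : 'I_n) : pred bool := [pred b | (j <= k) ==> (b == z j)].
have -> : #|block k z| = #|(family F : simpl_pred _)|.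
  by apply: eq_card => x; rewrite inE; apply: eq_forallb => j; rewrite inE.
rewrite card_family foldrE big_map big_enum /=.
transitivity (\prod_(j < n) (if j <= k then 1 else 2)).
  apply: eq_bigr => j _; rewrite /F; case: leqP => _ /=.
    by rewrite -(card1 (z j)); apply: eq_card.
  by rewrite -card_bool; apply: eq_card.
rewrite -(big_mkord xpredT (fun j => if j <= k then 1 else 2)) (@big_cat_nat _ _ _ k.+1) //=.
rewrite big_nat big1 ?mul1n => [|j /andP[_]]; last by rewrite ltnS => ->.
rewrite big_nat (eq_bigr (fun=> 2)) => [|j /andP[kj _]]; last by rewrite leqNgt kj.
by rewrite -big_nat prod_nat_const_nat.
Qed.

(** The threshold 8/(k+4) is four times the bound 2/(k+4) on the survival probability. *)
Definition crowded k f z : bool :=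
  8 * #|block k z| < (k + 4) * \sum_(x in block k z) unmatched f k x.

(** Double counting: by [block_sym], each point lies in [block k z] for exactly 2^(n-k-1) values of
    [z]. *)
Lemma unmatched_le_of_uncrowded k f : k < n ->
  (forall z, ~~ crowded k f z) -> (k + 4) * #|[set x | unmatched f k x]| <= 8 * 2 ^ n.
Proof.
move=> lt_kn few; have N0 : 0 < 2 ^ (n - k.+1) by rewrite expn_gt0.
rewrite -(leq_pmul2l N0) mulnCA (mulnCA _ 8).
have -> : 2 ^ (n - k.+1) * #|[set x | unmatched f k x]| =
          \sum_z \sum_(x in block k z) unmatched f k x.
  rewrite (exchange_big_dep xpredT) //= -sum1_card big_distrr /= big_mkcond /=.
  apply: eq_bigr => x _; rewrite inE sum_nat_const -(card_block x lt_kn) muln1.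
  have -> : #|[pred z | x \in block k z]| = #|block k x|.
    by apply: eq_card => z; rewrite [RHS]block_sym.
  by case: (unmatched f k x); rewrite ?muln1 ?muln0.
rewrite -(card_cube n) (mulnC (2 ^ _)) -sum_nat_const !big_distrr /=; apply: leq_sum => z _.
by move: (few z); rewrite /crowded card_block // -leqNgt.
Qed.

(** * Chernoff bound for one block *)

Lemma INR_expn2 m : INR (2 ^ m) = Rpower 2 (INR m).
Proof.
rewrite Rpower_pow; last lra.
by elim: m => // m IHm; rewrite expnS mult_INR IHm.
Qed.

(** From 1 + u <= e^u at u = 2/s, and e <= 4 in the form ln 2 > 1/2. *)
Lemma pow_add2_le s m : (0 < s -> (s + 2) ^ m <= s ^ m * Rpower 2 (4 * INR m / s))%R.
Proof.
move=> s0; have -> : Rpower 2 (4 * INR m / s) = (Rpower 2 (4 / s) ^ m)%R.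
  by rewrite -Rpower_pow ?Rpower_mult; [congr Rpower; field; lra | exact: exp_pos].
rewrite -Rpow_mult_distr; apply: pow_incr; split; first lra.
have -> : (s + 2 = s * (1 + 2 / s))%R by field; lra.
apply: Rmult_le_compat_l; first lra.
apply: Rle_trans (exp_ineq1_le _) _; rewrite /Rpower.
have le_ln : (2 / s <= 4 / s * ln 2)%R.
  have -> : (2 / s = 4 / s * / 2)%R by field; lra.
  apply: Rmult_le_compat_l; last by have := ln_lt_2; lra.
  by apply: Rlt_le; apply: Rdiv_lt_0_compat; lra.
by case: le_ln => [/exp_increasing|->]; [exact: Rlt_le | exact: Rle_refl].
Qed.

(** Markov's inequality for 2^count: the moment costs 2^(4m/s), the threshold [c] gains at least
    2^(8m/s). *)
Lemma exp_moment_cancel (s m B K c : nat) : 0 < s ->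
  s ^ m * (B * 2 ^ c) <= (s + 2) ^ m * K -> 8 * m <= c * s ->
  (INR B <= INR K * Rpower 2 (- (4 * INR m / INR s)))%R.
Proof.
move=> s_gt0 mgf /leP/le_INR; rewrite !mult_INR => le_c.
have s0 : (0 < INR s)%R by apply: lt_0_INR; apply/ltP.
have powE p j : INR (p ^ j) = (INR p ^ j)%R.
  by elim: j => // j IHj; rewrite expnS mult_INR IHj.
move/leP/le_INR: mgf; rewrite !mult_INR INR_expn2 !powE plus_INR => mgf.
have le_pow := pow_add2_le m s0.
have sm0 : (0 < INR s ^ m)%R by exact: pow_lt.
set a := (4 * INR m / INR s)%R in le_pow *.
have le_ac : (Rpower 2 (a + a) <= Rpower 2 (INR c))%R.
  apply: Rle_Rpower; first lra.
  apply: (Rmult_le_reg_r (INR s)) => //; apply: Rle_trans le_c.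
  by apply: Req_le; rewrite /a [INR 8]/=; field; lra.
have a0 : (0 < Rpower 2 a)%R by exact: exp_pos.
have B0 := pos_INR B; have K0 := pos_INR K.
rewrite Rpower_Ropp; apply: (Rmult_le_reg_r (Rpower 2 a * Rpower 2 a)).
  exact: Rmult_lt_0_compat.
apply: (Rmult_le_reg_l (INR s ^ m)) => //.
apply: (Rle_trans _ (INR s ^ m * (INR B * Rpower 2 (INR c)))%R).
  apply: Rmult_le_compat_l; first lra.
  by apply: Rmult_le_compat_l; rewrite // -Rpower_plus.
apply: Rle_trans mgf _.
apply: (Rle_trans _ (INR s ^ m * Rpower 2 a * INR K)%R).
  by apply: Rmult_le_compat_r.
by apply: Req_le; field; lra.
Qed.

Lemma card_crowded_le k z : k < n ->
  (INR #|[set f : boolfun n | crowded k f z]| <=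
   INR #|boolfun n| * Rpower 2 (- (4 * INR (2 ^ (n - k.+1)) / INR (k + 4))))%R.
Proof.
move=> lt_kn; set N := 2 ^ _; set s := k + 4; set B := #|_|.
have sumE f : \sum_(x in block k z) unmatched f k x = count (unmatched f k) (enum (block k z)).
  by rewrite -sum1_count big_enum_cond big_mkcondr.
have sizeE : size (enum (block k z)) = N by rewrite -cardE card_block.
(* The least integer strictly above 8N/s, hence a lower bound for the number of survivors in a
   crowded block. *)
pose c := (8 * N %/ s).+1.
have s_gt0 : 0 < s by rewrite /s addn4.
have mgf : s ^ N * (B * 2 ^ c) <= (s + 2) ^ N * M.
  rewrite -sizeE; apply: leq_trans (sum_exp_count_le (enum_uniq _)
    (fun x => @unmatched_local k x) _ (fun x _ => card_unmatched_le x lt_kn)).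
    rewrite leq_mul2l; apply/orP; right.
    rewrite /B -sum_nat_const [X in X <= _]big_mkcond /=; apply: leq_sum => f _.
    rewrite inE /crowded card_block // sumE; case: ltnP => // h.
    by rewrite leq_exp2l // /c ltn_divLR // [ltnRHS]mulnC.
  by move=> x y; rewrite !mem_enum; apply: block_disjoint.
apply: exp_moment_cancel mgf _ => //; exact/ltnW/ltn_ceil.
Qed.
End Survivors.

(** * The proportion of balanced functions *)

Lemma bin_le_central m j : 'C(m.*2, j) <= 'C(m.*2, m).
Proof.
wlog le_jm : j / j <= m => [half|].
  have [/half //|/ltnW le_mj] := leqP j m.
  have [le_j|lt_j] := leqP j m.*2; last by rewrite bin_small.
  by rewrite -bin_sub //; apply: half; rewrite -addnn in le_j *; lia.
rewrite -(subKn le_jm); elim: (m - j) => [|d IHd]; first by rewrite subn0.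
apply: leq_trans IHd; have [le_md|lt_dm] := leqP m d.
  by have -> : m - d.+1 = m - d by lia.
have := mul_bin_left m.*2 (m - d.+1); rewrite -addnn subnSK // => binE.
rewrite -(leq_pmul2l (_ : 0 < m - d)) ?subn_gt0 // binE leq_mul2r; apply/orP; right.
by lia.
Qed.

Lemma card_balanced n : #|[set f : boolfun n | balanced f]| = 'C(2 ^ n, 2 ^ n.-1).
Proof.
have inj : injective (fun f : boolfun n => [set x | f x]).
  by move=> f g /setP fg; apply/ffunP=> x; move: (fg x); rewrite !inE.
rewrite -card_cube -card_draws -(card_imset _ inj); apply: eq_card => A; rewrite [RHS]inE.
apply/imsetP/idP => [[f]|cardA]; first by rewrite inE => bal ->.
exists [ffun x => x \in A]; last by apply/setP=> x; rewrite inE ffunE.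
rewrite inE /balanced; apply: etrans cardA; congr (_ == _).
by apply: eq_card => x; rewrite inE ffunE.
Qed.

(** The central binomial coefficient is the largest of the 2^n + 1 <= 2^(n+1) coefficients summing
    to the number of all functions. *)
Lemma card_boolfun_le_balanced n : 0 < n ->
  #|boolfun n| <= 2 ^ n.+1 * #|[set f : boolfun n | balanced f]|.
Proof.
move=> n0; rewrite card_ffun card_bool card_cube card_balanced.
have -> : 2 ^ n = (2 ^ n.-1).*2 by rewrite -mul2n -expnS prednK.
set m := 2 ^ n.-1; have -> : 2 ^ n.+1 = m.*2 + m.*2.
  by rewrite addnn -!mul2n -!expnS prednK.
rewrite -{1}[2]/(1 + 1) expnDn.
apply: leq_trans (_ : \sum_(i < m.*2.+1) 'C(m.*2, m) <= _).
  by apply: leq_sum => i _; rewrite !exp1n !muln1 bin_le_central.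
rewrite sum_nat_const card_ord leq_mul2r -addn1 leq_add2l; apply/orP; right.
by rewrite double_gt0 expn_gt0.
Qed.

(** * Union bound and choice of constants *)

(** For n < 32 the allowed fraction 32/n of far points exceeds 1, so any mapping will do. *)
Lemma good_event_small n (f : boolfun n) : 0 < n -> n < 32 -> balanced f ->
  good_event (INR 32) (INR (5 + 2 * 32)) f.
Proof.
move=> n0 lt_n bal_f; have [phi [map_phi _]] := ex_near_mapping 0 n0 bal_f.
apply: good_event_far map_phi _ => //; apply: leq_mul; first exact: ltnW.
by rewrite -(card_cube n) max_card.
Qed.

Lemma good_event_uncrowded n (f : boolfun n) : 0 < n -> balanced f ->
  (forall z, ~~ crowded n./2 f z) -> good_event (INR 32) (INR (5 + 2 * 32)) f.
Proof.
move=> n0 bal_f few; have [phi [map_phi le_far]] := ex_near_mapping n./2 n0 bal_f.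
apply: good_event_far map_phi _ => //.
have := unmatched_le_of_uncrowded (_ : n./2 < n) few; rewrite ltn_half_double -addnn.
rewrite -{1}[n]addn0 ltn_add2l => /(_ n0).
move: le_far; set u := #|_|; move: (far phi) (2 ^ n) => d e le_du le_u.
apply: leq_trans (_ : (n./2 + 4).*2 * u <= _); last by rewrite -doubleMl; lia.
by apply: leq_mul => //; lia.
Qed.

(** The Chernoff exponent at k = n/2 must absorb 2n + 1, from the union bound (n) and from
    conditioning (n + 1), and leave 2^(n/8). With Q = 2^q the left side is at most 7Q times 2Q, the
    right side at least 2Q^4. *)
Lemma half_exp_bound n : 32 <= n ->
  (n./2 + 4) * ((2 * n).+1 + 2 ^ (n %/ 8).+1) <= 4 * 2 ^ (n - n./2.+1).
Proof.
move=> n32; set q := n %/ 8.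
have q4 : 4 <= q by rewrite /q; lia.
have leQ : 4 * q <= 2 ^ q.
  rewrite -(subnKC q4); elim: (q - 4) => // d IHd.
  by rewrite addnS expnS; lia.
have le_pow : 2 ^ (4 * q) <= 2 ^ (n - n./2) by rewrite leq_exp2l // /q; lia.
have -> : 4 * 2 ^ (n - n./2.+1) = 2 * 2 ^ (n - n./2).
  by rewrite (_ : n - n./2 = (n - n./2.+1).+1) ?expnS; lia.
apply: leq_trans (_ : 2 * 2 ^ (4 * q) <= _); last by rewrite leq_mul2l.
rewrite mulnC expnM; move: leQ; rewrite expnS; set Q := 2 ^ q => leQ.
have -> : (2 ^ 4) ^ q = Q * Q * (Q * Q) by rewrite -expnM /Q -!expnD; congr (2 ^ _); lia.
apply: leq_trans (_ : (7 * Q) * (2 * Q) <= _).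
  by apply: leq_mul; rewrite /q in leQ q4 *; lia.
have : 7 <= Q * Q by clear - leQ q4; nia.
rewrite (mulnACA 7); move: (Q * Q) => P; clear; nia.
Qed.

Lemma card_ex_crowded_le n k : k < n ->
  (INR #|[set f : boolfun n | [exists z, crowded k f z]]| <=
   INR (2 ^ n) * (INR #|boolfun n| *
     Rpower 2 (- (4 * INR (2 ^ (n - k.+1)) / INR (k + 4)))))%R.
Proof.
move=> lt_kn.
(* The union bound is taken as 2^n times the largest term. *)
have [z0 maxE] : {z0 | \max_z #|[set f : boolfun n | crowded k f z]| =
                       #|[set f : boolfun n | crowded k f z0]|}.
  by apply: eq_bigmax; rewrite card_cube expn_gt0.
apply: Rle_trans (Rmult_le_compat_l _ _ _ (pos_INR _) (card_crowded_le z0 lt_kn)).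
rewrite -mult_INR; apply/le_INR/leP; rewrite multE -maxE -(card_cube n) -sum_nat_const.
apply: leq_trans (_ : \sum_z #|[set f : boolfun n | crowded k f z]| <= _); last first.
  by apply: leq_sum => z _; apply: leq_bigmax.
have -> : [set f : boolfun n | [exists z, crowded k f z]] =
          \bigcup_z [set f : boolfun n | crowded k f z].
  by apply/setP=> f; rewrite inE; apply/existsP/bigcupP => -[z]; rewrite ?inE; exists z; rewrite ?inE.
elim/big_rec2: _ => [|z a A _ le_A]; first by rewrite cards0.
by apply: leq_trans (leq_card_setU _ _) _; rewrite leq_add2l.
Qed.

Lemma prob_balanced_ge n (E : boolfun n -> bool) e :
  (INR #|[set f : boolfun n | balanced f && ~~ E f]| <=
   e * INR #|[set f : boolfun n | balanced f]|)%R ->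
  (1 - e <= prob_balanced E)%R.
Proof.
have bal0 : (0 < INR #|[set f : boolfun n | balanced f]|)%R.
  apply: lt_0_INR; apply/ltP; rewrite card_balanced bin_gt0.
  by rewrite leq_exp2l ?leq_pred.
set good := [set f | balanced f && E f]; set bad := [set f | balanced f && ~~ E f].
have cardE : INR #|[set f : boolfun n | balanced f]| = (INR #|good| + INR #|bad|)%R.
  rewrite -plus_INR -(cardsID [set f | E f] [set f | balanced f]); congr INR.
  by congr (_ + _); apply: eq_card => f; rewrite !inE // andbC.
move=> le_e; apply: (Rmult_le_reg_r (INR #|[set f : boolfun n | balanced f]|)) => //.
rewrite /prob_balanced -/good /Rdiv Rmult_assoc Rinv_l; last lra.
by rewrite cardE in le_e *; lra.
Qed.

Theorem theorem4 :
  exists (c C C' : R), Rlt 0 c /\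
    forall n : nat, leq 1 n ->
      Rle (Rminus 1 (Rpower 2 (Ropp (Rpower 2 (Rmult c (INR n))))))
          (prob_balanced (@good_event n C C')).
Proof.
(* The rate 1/8 comes from [half_exp_bound]; 32 is both [C] and the cutoff for small n; the last
   value is 5 + 2k at k = 32. *)
exists (/ 8)%R, (INR 32), (INR (5 + 2 * 32)); split=> [|n n0]; first lra.
apply: prob_balanced_ge.
have [lt_n|le_n] := ltnP n 32.
  have -> : #|[set f : boolfun n | balanced f &&
              ~~ good_event (INR 32) (INR (5 + 2 * 32)) f]| = 0.
    apply/eqP; rewrite cards_eq0; apply/eqP/setP=> f; rewrite !inE.
    by case: (boolP (balanced f)) => //= bal_f; rewrite good_event_small.
  by apply: Rmult_le_pos (pos_INR _); apply: Rlt_le; apply: exp_pos.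
have lt_kn : n./2 < n by lia.
set badc := #|_|; set balc := #|_|.
have le_bad : (INR badc <= INR #|[set f : boolfun n | [exists z, crowded n./2 f z]]|)%R.
  apply/le_INR/leP/subset_leq_card/subsetP=> f; rewrite !inE => /andP[bal_f].
  by apply: contraR; rewrite negb_exists => /forallP; apply: good_event_uncrowded.
apply: Rle_trans le_bad (Rle_trans _ _ _ (card_ex_crowded_le lt_kn) _).
have := le_INR _ _ (elimT leP (card_boolfun_le_balanced n0)).
rewrite mult_INR !INR_expn2 -/balc => le_M.
have s0 : (0 < INR (n./2 + 4))%R by apply: lt_0_INR; apply/ltP; rewrite addn4.
have := le_INR _ _ (elimT leP (half_exp_bound le_n)).
rewrite mult_INR (mult_INR 4) (plus_INR (2 * n).+1) !INR_expn2 => le_exp.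
set t := (4 * _ / _)%R.
(* Rounding n/8 up in [half_exp_bound] is what allows the real exponent n/8 here. *)
have le_t : (INR (2 * n).+1 + Rpower 2 (/ 8 * INR n) <= t)%R.
  apply: (Rmult_le_reg_r (INR (n./2 + 4))) => //.
  have -> : (t * INR (n./2 + 4) = INR 4 * Rpower 2 (INR (n - n./2.+1)))%R.
    by rewrite /t [INR 4]/=; field; lra.
  apply: Rle_trans le_exp; rewrite Rmult_comm; apply: Rmult_le_compat_l; first lra.
  apply: Rplus_le_compat_l; apply: Rle_Rpower; first lra.
  apply: (Rmult_le_reg_l 8); first lra.
  rewrite -Rmult_assoc Rinv_r ?Rmult_1_l; last lra.
  have -> : (8 = INR 8)%R by rewrite /=; lra.
  by rewrite -mult_INR; apply/le_INR/leP; lia.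
apply: (Rle_trans _ (Rpower 2 (INR n) * (Rpower 2 (INR n.+1) * INR balc * Rpower 2 (- t)))%R).
  apply: Rmult_le_compat_l; first by apply: Rlt_le; apply: exp_pos.
  by apply: Rmult_le_compat_r; first by apply: Rlt_le; apply: exp_pos.
rewrite (Rmult_assoc (Rpower 2 (INR n.+1))) (Rmult_comm (INR balc)) -!Rmult_assoc.
apply: Rmult_le_compat_r; first exact: pos_INR.
rewrite -!Rpower_plus; apply: Rle_Rpower; first lra.
by move: le_t; rewrite !S_INR mult_INR [INR 2]/=; lra.
Qed.
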